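(* For any two integers $s\geq 1$ and $t\geq 3$ there exists a constant $C_{s,t}$ such that for every positive integer $n$, $$\mathrm{ex}(n,L'_{s,t})\leq C_{s,t}\, n^{3/2-\frac{1}{4t-6}}.$$
   Context: For a graph $H$, $\mathrm{ex}(n,H)$ denotes the maximum number of edges in an $n$-vertex graph containing no subgraph isomorphic to $H$. The subdivision of a graph $L$ is the bipartite graph with parts $V(L)$ and $E(L)$ in which $v\in V(L)$ is adjacent to $e\in E(L)$ if and only if $v$ is an endpoint of $e$. For integers $s\geq 1$, $t\geq 3$, $L_{s,t}$ is the graph on vertex set $S\cup T$ with $S\cap T=\emptyset$, $|S|=s$, $|T|=t-1$, in which two distinct vertices $x,y$ are adjacent if and only if $x\in T$ or $y\in T$ (i.e. $K_{s+t-1}$ with the edges of a $K_s$ removed). $L'_{s,t}$ is the subdivision of $L_{s,t}$. *)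

(* Defs.v *)
From mathcomp Require Import all_boot.
Set Implicit Arguments. Unset Strict Implicit. Unset Printing Implicit Defensive.

Definition simple_graph (V : finType) (E : {set {set V}}) : bool :=
  [forall e in E, #|e| == 2].

Definition contains_sub (n : nat) (G : {set {set 'I_n}})
    (W : finType) (H : {set {set W}}) : bool :=
  [exists f : {ffun W -> 'I_n},
     injectiveb f && [forall e in H, (f @: e) \in G]].

Definition ex (n : nat) (W : finType) (H : {set {set W}}) : nat :=
  \max_(G : {set {set 'I_n}} | simple_graph G && ~~ contains_sub G H) #|G|.

Definition sub_vert (V : finType) (E : {set {set V}}) : finType :=
  (V + {e : {set V} | e \in E})%type.

Definition subdivision (V : finType) (E : {set {set V}}) : {set {set sub_vert E}} :=
  [set [set (inl p.1 : sub_vert E); inr p.2]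
    | p in [set p : V * {e : {set V} | e \in E} | p.1 \in val p.2]].

Definition VL (s t : nat) : finType := ('I_s + 'I_(t - 1))%type.
Definition inT (s t : nat) (x : VL s t) : bool := if x is inr _ then true else false.
Definition EL (s t : nat) : {set {set VL s t}} :=
  [set e : {set VL s t} | (#|e| == 2) && [exists x in e, inT x]].

Definition L' (s t : nat) := subdivision (EL s t).

(* Main.v *)
(** Write D for a constant at least the order of L'_{s,t}, and work in a graph
all of whose degrees are at most a constant times delta, with linearly many
vertices A of degree at least delta. If D-heavy pairs (codegree at least D) of A
contain a clique on |V(L)| vertices, the subdivision vertices can be chosen
greedily. Otherwise the light pairs (codegree in (0, D)) have no large
independent set inside a neighbourhood, so weak Turan and Cauchy-Schwarz give,
in every U with delta |U| >> n, a vertex with about delta^2 |U| / n light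
neighbours in U. Picking t - 1 vertices this way, the common light
neighbourhood shrinks from about n to about n (delta^2 / n)^(t-1), which is a
large multiple of delta exactly when delta^(2t-3) >> n^(t-2). Each choice only
forbids O(delta) vertices if one wants no triple with at least one member among
the first t - 1 vertices to have a common neighbour; this makes the
subdivision vertices automatically distinct.

Regularity comes from a minimal counterexample X to e(X)^(2t-3) <= C |X|^(3t-5):
if H is the set of vertices of degree at least K times the average, cover X by
K sets Z of size about |X|/K; minimality bounds the number of edges in each
H u Z, so few edges meet H, and X \ H is almost regular from above. Note that
(3t-5)/(2t-3) = 3/2 - 1/(4t-6). *)

From mathcomp Require Import all_boot zify.
From Stdlib Require Import Reals Lra.
Require Import Defs.
From mathcomp Require Import ssrnat.
Set Implicit Arguments. Unset Strict Implicit. Unset Printing Implicit Defensive.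

(** * Light pairs *)

(** Each choice removes the vertex and its neighbours, at most [k] vertices in all, so [r] choices
    never exhaust [X]. *)
Lemma greedy_independent (V : finType) (R : rel V) (r k : nat) (X : {set V}) :
  symmetric R -> 0 < k ->
  {in X, forall x, #|[set y in X | R x y]| < k} -> r * k <= #|X| ->
  exists2 Q : {set V}, (Q \subset X) && (#|Q| == r)
    & {in Q &, forall x y, x != y -> ~~ R x y}.
Proof.
move=> symR k_gt0; elim: r X => [|r IH] X degX leX.
  by exists set0; rewrite ?sub0set ?cards0 // => x y; rewrite inE.
have /card_gt0P [x xX] : 0 < #|X| by nia.
pose Z := x |: [set y in X | R x y].
have leZ : #|Z| <= k.
  by rewrite (leq_trans (leq_card_setU _ _)) // cards1 add1n degX.
have leXZ : r * k <= #|X :\: Z|.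
  have := cardsID Z X; have := subset_leq_card (subsetIr X Z); lia.
have [] := IH (X :\: Z) _ leXZ.
  move=> y /setDP[yX _]; apply: leq_ltn_trans (degX y yX).
  apply/subset_leq_card/subsetP => z; rewrite !inE => /andP[/andP[_ ->] ->] //.
move=> Q /andP[QX /eqP cQ] indQ.
have xQ : x \notin Q.
  by apply/negP => /(subsetP QX); rewrite !inE eqxx.
have nRx y : y \in Q -> ~~ R x y.
  move=> /(subsetP QX); rewrite !inE => /andP[/norP[_]].
  by rewrite negb_and => /orP[/negP nX /nX|].
exists (x |: Q).
  rewrite cardsU1 xQ cQ add1n eqxx andbT subUset sub1set xX.
  exact: subset_trans QX (subsetDl _ _).
move=> y z; rewrite !inE => /orP[/eqP->|yQ] /orP[/eqP->|zQ] nyz.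
- by rewrite eqxx in nyz.
- exact: nRx.
- by rewrite symR nRx.
- exact: indQ.
Qed.

(** Turan's bound up to a constant: more than half of [N] must have [(deg x).+1] above
    [#|N| / (2 * r)]. *)
Lemma weak_turan (V : finType) (R : rel V) (r : nat) (N : {set V}) :
  symmetric R -> 0 < r ->
  (forall Q : {set V}, Q \subset N -> #|Q| = r ->
     ~ {in Q &, forall x y, x != y -> ~~ R x y}) ->
  #|N| ^ 2 <= 4 * r * (\sum_(x in N) #|[set y in N | R x y]| + #|N|).
Proof.
move=> symR r_gt0 noQ; set deg := fun x => #|[set y in N | R x y]|.
set d := #|N|; pose X := [set x in N | 2 * r * (deg x).+1 <= d].
have subXN : X \subset N by apply/subsetP => x; rewrite inE => /andP[].
(* If at least half of [N] had low degree, a greedy choice inside [X] would give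
   an independent set of size [r]. *)
have [leX|ltX] := leqP d (2 * #|X|).
  have [->//|d_gt0] := posnP d.
  have /card_gt0P [x0 ] : 0 < #|X| by lia.
  rewrite inE => /andP[_ lex0].
  pose k := d %/ (2 * r).
  have k_gt0 : 0 < k by rewrite divn_gt0; nia.
  have lek : r * k <= #|X|.
    have : k * (2 * r) <= d by apply: leq_divM.
    nia.
  have [|Q /andP[QX /eqP cQ] indQ] := greedy_independent symR k_gt0 _ lek.
    move=> x; rewrite inE => /andP[xN]; rewrite mulnC -leq_divRL; last by nia.
    apply: leq_ltn_trans; apply/subset_leq_card/subsetP => y.
    by rewrite !inE => /andP[/andP[-> _] ->].
  by case: (noQ Q (subset_trans QX subXN) cQ).
have -> : \sum_(x in N) #|[set y in N | R x y]| + #|N| = \sum_(x in N) (deg x).+1.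
  by rewrite -sum1_card -big_split; apply: eq_bigr => x _; rewrite /= addn1.
have le1 : (d - #|X|) * d <= 2 * r * \sum_(x in N) (deg x).+1.
  rewrite -(cardsDS subXN) -sum_nat_const big_distrr /=.
  rewrite [X in _ <= X](big_setID X) /= (setIidPr subXN).
  apply: leq_trans (leq_addl _ _); apply: leq_sum => x.
  by rewrite !inE => /andP[nX xN]; move: nX; rewrite xN /= -ltnNge => /ltnW.
have le2 : d * d <= 2 * (d - #|X|) * d by rewrite leq_mul2r; apply/orP; right; lia.
move: le1 le2; move: (\sum_(x in N) _) (d - _) => S m.
rewrite -mulnn -!mulnA; lia.
Qed.

(** Cauchy-Schwarz, from [2 * a * b <= a ^ 2 + b ^ 2] summed over all ordered pairs of indices. *)
Lemma sqr_sum_le (I : finType) (P : {set I}) (f : I -> nat) :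
  (\sum_(i in P) f i) ^ 2 <= #|P| * \sum_(i in P) f i ^ 2.
Proof.
rewrite -(leq_pmul2l (isT : 0 < 2)) -mulnn big_distrlr /= big_distrr /=.
have -> : 2 * (#|P| * \sum_(i in P) f i ^ 2) =
    \sum_(i in P) \sum_(j in P) (f i ^ 2 + f j ^ 2).
  under [RHS]eq_bigr => i _ do rewrite big_split /= sum_nat_const.
  by rewrite big_split /= sum_nat_const -big_distrr /= mul2n addnn.
apply: leq_sum => i _; rewrite big_distrr /=; apply: leq_sum => j _.
exact: nat_Cauchy.
Qed.

Section Codegrees.

Variables (V : finType) (e : rel V) (D : nat).

Definition nb (x : V) : {set V} := [set y | e x y].
Definition conb (x y : V) : {set V} := nb x :&: nb y.
(** A positive codegree provides a subdivision vertex; a codegree below [D] limits the vertices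
    spoiled by a choice. *)
Definition light (x y : V) : bool := (x != y) && (0 < #|conb x y| < D).

Lemma light_sym : symmetric light.
Proof. by move=> x y; rewrite /light eq_sym /conb setIC. Qed.

Hypothesis e_sym : symmetric e.

(** Double counting: a light ordered pair of [U] occurs once for each common neighbour, hence fewer
    than [D] times. *)
Lemma sum_light_conb (B U : {set V}) : (forall x y, e x y -> y \in B) ->
  \sum_(b in B) \sum_(x in nb b :&: U) #|[set y in nb b :&: U | light x y]|
    <= D * \sum_(x in U) #|[set y in U | light x y]|.
Proof.
move=> eB; rewrite big_distrr /=.
rewrite (exchange_big_dep (mem U)) /=; last by move=> b x _ /setIP[].
apply: leq_sum => x xU.
under eq_bigr => b _ do rewrite -sum1_card.
rewrite (exchange_big_dep (mem [set y in U | light x y])) /=; last first.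
  by move=> b y _; rewrite !inE => /andP[/andP[_ ->] ->].
rewrite mulnC -sum_nat_const; apply: leq_sum => y.
rewrite inE => /andP[yU lxy]; rewrite sum1_card.
case/and3P: (lxy) => _ _ /ltnW; apply: leq_trans.
apply/subset_leq_card/subsetP => b; rewrite !inE unfold_in /= !inE.
by case/andP=> /andP[_ /andP[bx _]] /andP[/andP[bY _] _]; rewrite !(e_sym _ b) bx.
Qed.

(** Weak Turan is summed over the sets [nb b :&: U], Cauchy-Schwarz bounds their squared sizes from
    below, and [u] has the most light neighbours in [U]. *)
Lemma exists_light_degree (B U : {set V}) (r n delta : nat) :
  (forall x y, e x y -> y \in B) -> #|B| <= n -> 0 < r -> U != set0 ->
  (forall Q : {set V}, Q \subset U -> #|Q| = r ->
     ~ {in Q &, forall x y, x != y -> D <= #|conb x y|}) ->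
  {in U, forall x, delta <= #|nb x|} ->
  8 * r * n <= delta * #|U| ->
  exists2 u, u \in U &
    delta ^ 2 * #|U| <= 8 * r * D * n * #|[set y in U | light u y]|.
Proof.
move=> eB leBn r_gt0 U0 noQ degU leU.
pose N b := nb b :&: U.
pose S1 := \sum_(b in B) #|N b|.
pose S2 := \sum_(b in B) #|N b| ^ 2.
pose L := \sum_(b in B) \sum_(x in N b) #|[set y in N b | light x y]|.
have S1E : S1 = \sum_(x in U) #|nb x|.
  rewrite /S1; under eq_bigr => b _ do rewrite -sum1_card.
  rewrite (exchange_big_dep (mem U)) /=; last by move=> b x _ /setIP[].
  apply: eq_bigr => x xU; rewrite sum1_card; apply: eq_card => b.
  rewrite unfold_in /= !inE xU andbT e_sym andb_idl //; exact: eB.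
have leS1 : delta * #|U| <= S1.
  by rewrite S1E mulnC -sum_nat_const; apply: leq_sum.
have S12 : S1 ^ 2 <= #|B| * S2 by apply: sqr_sum_le.
have leS2 : S2 <= 4 * r * (L + S1).
  rewrite /S2 /L /S1 -big_split big_distrr /=; apply: leq_sum => b bB.
  (* Inside a neighbourhood all codegrees are positive, so a set without light pairs is heavy. *)
  apply: weak_turan light_sym r_gt0 _ => Q QN cQ indQ.
  apply: (noQ Q (subset_trans QN (subsetIr _ _)) cQ) => x y xQ yQ nxy.
  have cxy : 0 < #|conb x y|.
    apply/card_gt0P; exists b; move: (subsetP QN _ xQ) (subsetP QN _ yQ).
    by rewrite !inE !(e_sym b) => /andP[-> _] /andP[-> _].
  by have := indQ x y xQ yQ nxy; rewrite /light nxy cxy /= -leqNgt.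
have leL := sum_light_conb U eB; rewrite -/L in leL.
pose lsum := \sum_(x in U) #|[set y in U | light x y]|.
have [u uU maxu] : exists2 u, u \in U & forall x, x \in U ->
    #|[set y in U | light x y]| <= #|[set y in U | light u y]|.
  have [u0 u0U] := set0Pn _ U0.
  case: (arg_maxnP (fun x => #|[set y in U | light x y]|) u0U) => u uU mx.
  by exists u.
exists u => //; set l := #|_| in maxu *.
have lel : lsum <= #|U| * l by rewrite -sum_nat_const; apply: leq_sum.
have Upos : 0 < #|U| by rewrite card_gt0.
have le1 : S1 ^ 2 <= n * (4 * r * (L + S1)).
  apply: leq_trans S12 _; exact: leq_mul.
(* Since [8 * r * n <= S1], the linear term of weak Turan takes up at most half of [S1 ^ 2]. *)
have le2 : S1 ^ 2 <= 8 * r * n * L.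
  have : 8 * r * n * S1 <= S1 * S1 by rewrite leq_mul2r (leq_trans leU leS1) orbT.
  nia.
have le3 : (delta * #|U|) ^ 2 <= S1 ^ 2 by rewrite leq_exp2r.
have le4 : L <= D * (#|U| * l).
  by apply: leq_trans leL _; rewrite leq_mul2l lel orbT.
rewrite -(leq_pmul2r Upos).
have : 8 * r * n * L <= 8 * r * n * (D * (#|U| * l)) by rewrite leq_mul2l le4 orbT.
move: le3 le2; rewrite expnMn; nia.
Qed.

End Codegrees.

(** * Choosing the branch vertices *)

Section Spread.

Variables (V : finType) (e : rel V) (D : nat).
Hypotheses (e_sym : symmetric e) (e_irr : irreflexive e).

Local Notation nb := (nb e).
Local Notation conb := (conb e).
Local Notation light := (light e D).

(* [T] and [W :\: T] will carry the parts T and S of L_{s,t}. *)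
Definition spread (T W : {set V}) : Prop :=
  [/\ {in W &, forall x y, ~~ e x y},
      {in T & W, forall x y, x != y -> light x y}
    & forall x y z, x \in T -> y \in W -> z \in W ->
        x != y -> x != z -> y != z -> conb x y :&: nb z = set0].

(* [joinable T W z] is what [z] must satisfy for [spread T W] to extend to
   [spread T (z |: W)]. *)
Definition joinable (T W : {set V}) (z : V) : Prop :=
  [/\ z \notin W, {in W, forall x, ~~ e x z}, {in T, forall x, light x z}
    & {in T & W, forall x y, x != y -> conb x y :&: nb z = set0}].

Lemma conbC x y : conb x y = conb y x.
Proof. exact: setIC. Qed.

Lemma spread_joinS (T W : {set V}) z : T \subset W -> spread T W -> joinable T W z ->
  spread T (z |: W).
Proof.
move=> TW [ind lnk tri] [zW zind zlnk ztri]; split.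
- move=> x y; rewrite !inE => /orP[/eqP->|xW] /orP[/eqP->|yW].
  + by rewrite e_irr.
  + by rewrite e_sym zind.
  + exact: zind.
  + exact: ind.
- move=> x y xT; rewrite !inE => /orP[/eqP->|yW] nxy; [exact: zlnk|exact: lnk].
- move=> x y z' xT; rewrite !inE => /orP[/eqP->|yW] /orP[/eqP->|zW'] nxy nxz nyz.
  + by rewrite eqxx in nyz.
  + by rewrite setIAC ztri.
  + exact: ztri.
  + exact: tri.
Qed.

Lemma spread_joinT (W : {set V}) z : spread W W -> joinable W W z ->
  spread (z |: W) (z |: W).
Proof.
move=> spW jz; have [ind lnk tri] := spread_joinS (subxx W) spW jz.
have [zW zind zlnk ztri] := jz; split=> //.
- move=> x y; rewrite !inE => /orP[/eqP->|xW] yzW nxy; last first.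
    by apply: lnk => //; rewrite !inE.
  case/orP: yzW nxy => [/eqP->|yW]; rewrite ?eqxx // => _.
  by rewrite light_sym zlnk.
- move=> x y z'; rewrite !inE => /orP[/eqP->|xW] yW zW' nxy nxz nyz; last first.
    by apply: tri => //; rewrite !inE.
  case/orP: yW nxy nyz => [/eqP->|yW]; rewrite ?eqxx // => nxy nyz.
  case/orP: zW' nxz nyz => [/eqP->|zW']; rewrite ?eqxx // => nxz nyz.
  by rewrite /conb -setIA setIC ztri.
Qed.

(** What to discard when [x] joins: the last union holds every vertex that would form, with [x] and
    some [u] in [T], a triple with a common neighbour. *)
Definition blocked (T : {set V}) (x : V) : {set V} :=
  x |: (nb x :|: \bigcup_(u in T) \bigcup_(b in conb u x) nb b).

Lemma blocked_tri (T : {set V}) x z u : u \in T -> z \notin blocked T x ->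
  conb u x :&: nb z = set0.
Proof.
move=> uT; rewrite !inE !negb_or => /and3P[_ _ nz].
apply/setP => b; rewrite !inE; apply/negP => /andP[/andP[ub xb] zb].
case/negP: nz; apply/bigcupP; exists u => //; apply/bigcupP; exists b.
  by rewrite !inE ub xb.
by rewrite inE e_sym.
Qed.

Lemma joinable_joinS (T W : {set V}) x z : joinable T W x -> joinable T W z ->
  z \notin blocked T x -> joinable T (x |: W) z.
Proof.
move=> [xW xind xlnk xtri] [zW zind zlnk ztri] nbl.
have := nbl; rewrite !inE !negb_or => /and3P[nzx nezx _]; split=> //.
- by rewrite !inE (negbTE nzx).
- by move=> y; rewrite !inE => /orP[/eqP->|/zind].
- move=> u y uT; rewrite !inE => /orP[/eqP->|yW] nuy; last exact: ztri.
  exact: blocked_tri uT nbl.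
Qed.

(** The new triples consist of [x], [z] and any [y] in [W]; as [T] is all of [W] here, [blocked W x]
    still covers them. *)
Lemma joinable_joinT (W : {set V}) x z : joinable W W x -> joinable W W z ->
  z \notin blocked W x -> light x z -> joinable (x |: W) (x |: W) z.
Proof.
move=> jx jz nbl lxz; have [zW zind zlnk ztri] := joinable_joinS jx jz nbl.
split=> //.
- by move=> y; rewrite !inE => /orP[/eqP->|/zlnk].
- move=> u y; rewrite !inE => /orP[/eqP->|uW] yxW nuy; last first.
    by apply: ztri; rewrite ?inE.
  case/orP: yxW nuy => [/eqP->|yW]; rewrite ?eqxx // => nxy.
  by rewrite conbC (blocked_tri yW nbl).
Qed.

Lemma card_blocked (T : {set V}) x (m : nat) : (forall y, #|nb y| <= m) ->
  {in T, forall u, light u x} -> #|blocked T x| <= 1 + m + #|T| * (D * m).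
Proof.
move=> degm lT; rewrite /blocked -addnA.
apply: leq_trans (leq_card_setU _ _) _; rewrite cards1 leq_add2l.
apply: leq_trans (leq_card_setU _ _) _; rewrite leq_add //.
have cardU (I : finType) (P : {set I}) (F : I -> {set V}) k :
    {in P, forall i, #|F i| <= k} -> #|\bigcup_(i in P) F i| <= #|P| * k.
  move=> leF; rewrite -sum_nat_const; apply: leq_trans (leq_sum _ leF).
  elim/big_rec2: _ => [|i A n _ le]; first by rewrite cards0.
  by apply: leq_trans (leq_card_setU _ _) _; rewrite leq_add2l.
apply: (cardU) => u uT; apply: leq_trans (cardU _ _ _ m _) _ => //.
by rewrite leq_mul2r; case/and3P: (lT u uT) => _ _ /ltnW ->; rewrite orbT.
Qed.

(** As [T] stays fixed, each of the [s] new vertices costs the same number of candidates. *)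
Lemma spread_extendS (m s : nat) (T W U : {set V}) :
  (forall y, #|nb y| <= m) -> T \subset W -> spread T W ->
  {in U, forall z, joinable T W z} ->
  s * (1 + m + #|T| * (D * m)) <= #|U| ->
  exists2 W' : {set V}, spread T W' & (T \subset W') && (#|W'| == #|W| + s).
Proof.
move=> degm; elim: s W U => [|s IH] W U TW spW jU leU.
  by exists W; rewrite // TW addn0 eqxx.
have /card_gt0P [x xU] : 0 < #|U| by lia.
have jx := jU x xU; have [xW _ xlnk _] := jx.
have lebl := card_blocked degm xlnk.
have TxW : T \subset x |: W by apply: subset_trans TW (subsetUr _ _).
have [|||W' spW' /andP[TW' /eqP cW']] := IH (x |: W) (U :\: blocked T x) TxW.
- exact: spread_joinS.
- by move=> z /setDP[zU nbl]; apply: joinable_joinS => //; apply: jU.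
- have := cardsID (blocked T x) U.
  have := subset_leq_card (subsetIr U (blocked T x)); lia.
exists W' => //; rewrite TW' cW' cardsU1 xW /=; apply/eqP; lia.
Qed.

Variables (A B : {set V}) (r n delta kappa t s : nat).
Hypotheses (eB : forall x y, e x y -> y \in B) (leBn : #|B| <= n).
Hypotheses (r_gt0 : 0 < r) (D_gt0 : 0 < D) (n_gt0 : 0 < n) (s_gt0 : 0 < s).
Hypothesis delta_gt0 : 0 < delta.
Hypothesis no_heavy : forall Q : {set V}, Q \subset A -> #|Q| = r ->
  ~ {in Q &, forall x y, x != y -> D <= #|conb x y|}.
Hypothesis degA : {in A, forall x, delta <= #|nb x|}.
Hypothesis deg_le : forall x, #|nb x| <= kappa * delta.

(* Extending by one vertex forbids at most [loss * delta] vertices, and choosing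
   one more vertex of T shrinks the candidates by a factor [delta ^ 2 / (rate * n)]. *)
Let loss := 1 + kappa + t * (D * kappa).
Let rate := 16 * r * D.

Lemma card_blocked_loss (T : {set V}) x : #|T| <= t -> {in T, forall u, light u x} ->
  #|blocked T x| <= loss * delta.
Proof.
move=> leT lT; apply: leq_trans (card_blocked deg_le lT) _.
have : #|T| * (D * (kappa * delta)) <= t * (D * (kappa * delta)).
  by rewrite leq_mul2r leT orbT.
rewrite /loss; nia.
Qed.

(** The light neighbours of [u] number at least twice the bound on blocked vertices, so half of them
    survive; this turns the 8 of [exists_light_degree] into the 16 of [rate]. *)
Lemma spread_stepT (W U : {set V}) :
  #|W| <= t -> U \subset A -> spread W W -> {in U, forall z, joinable W W z} ->
  rate * (s * loss) * n <= delta * #|U| ->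
  exists u, exists2 U' : {set V}, [/\ u \notin W, spread (u |: W) (u |: W),
    U' \subset U & {in U', forall z, joinable (u |: W) (u |: W) z}]
    & delta ^ 2 * #|U| <= rate * n * #|U'|.
Proof.
move=> leW UA spW jU leU.
have loss_gt0 : 0 < loss by rewrite /loss.
have rate_gt0 : 0 < rate by rewrite /rate !muln_gt0 r_gt0.
have lossn : rate * loss * n <= delta * #|U|.
  apply: leq_trans leU; rewrite leq_mul2r leq_mul2l leq_pmull //.
  by rewrite !orbT.
have U0 : U != set0.
  rewrite -card_gt0 lt0n; apply: contraTneq lossn => ->.
  by rewrite muln0 -ltnNge (muln_gt0 _ n) (muln_gt0 _ loss) rate_gt0 loss_gt0.
have [|||u uU lu] := exists_light_degree e_sym eB leBn r_gt0 U0 (D := D) (delta := delta).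
- by move=> Q QU; apply: no_heavy; apply: subset_trans QU UA.
- by move=> x xU; apply: degA; apply: (subsetP UA).
- apply: leq_trans lossn; rewrite leq_mul2r; apply/orP; right.
  by rewrite /rate; nia.
have ju := jU u uU; have [uW _ ulnk _] := ju.
pose L := [set y in U | light u y]; rewrite -/L in lu.
exists u, (L :\: blocked W u).
  split=> //; first exact: spread_joinT.
    apply: subset_trans (subsetDl _ _) _; apply/subsetP => y.
    by rewrite inE => /andP[].
  move=> z /setDP[]; rewrite inE => /andP[zU lz] nbl.
  by apply: joinable_joinT => //; apply: jU.
have lebl := card_blocked_loss leW ulnk.
have leL : 2 * (loss * delta) <= #|L|.
  have pos : 0 < 8 * r * D * n by rewrite !muln_gt0 r_gt0 D_gt0.
  rewrite -(leq_pmul2l pos); apply: leq_trans lu.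
  have : delta * (rate * loss * n) <= delta * (delta * #|U|).
    by rewrite leq_mul2l lossn orbT.
  rewrite /rate; nia.
have le2 : #|L| <= 2 * #|L :\: blocked W u|.
  have := cardsID (blocked W u) L.
  have := subset_leq_card (subsetIr L (blocked W u)); lia.
apply: leq_trans lu _; rewrite /rate.
have : 8 * r * D * n * #|L| <= 8 * r * D * n * (2 * #|L :\: blocked W u|).
  by rewrite leq_mul2l le2 orbT.
nia.
Qed.

(** At least [(delta ^ 2 / (rate * n)) ^ m.+1 * #|U|] candidates survive [m.+1] steps; the last
    hypothesis makes this at least [s * loss * delta], enough for choosing S afterwards. *)
Lemma spread_extendT (m : nat) (W U : {set V}) :
  #|W| + m < t -> U \subset A -> spread W W ->
  {in U, forall z, joinable W W z} ->
  rate * (s * loss) * n <= delta * #|U| ->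
  rate * (s * loss) * n * (rate * n) ^ m <= delta ^ (2 * m).+1 * #|U| ->
  exists T U' : {set V}, [/\ #|T| = #|W| + m.+1, spread T T,
    {in U', forall z, joinable T T z} & s * loss * delta <= #|U'|].
Proof.
have rn_gt0 : 0 < rate * n by rewrite /rate !muln_gt0 r_gt0 D_gt0.
elim: m W U => [|m IH] W U leW UA spW jU leU leUm.
  have {}leW : #|W| <= t by lia.
  have [u [U' [uW spu U'U jU'] leU']] := spread_stepT leW UA spW jU leU.
  exists (u |: W), U'; split=> //; first by rewrite cardsU1 uW addn1.
  rewrite -(leq_pmul2l rn_gt0); apply: leq_trans leU'; rewrite -mulnn -mulnA.
  have : delta * (rate * (s * loss) * n) <= delta * (delta * #|U|).
    by rewrite leq_mul2l leU orbT.
  nia.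
have leWt : #|W| <= t by lia.
have [u [U' [uW spu U'U jU'] leU']] := spread_stepT leWt UA spW jU leU.
have cW : #|u |: W| = #|W|.+1 by rewrite cardsU1 uW.
have U_gt0 : 0 < #|U|.
  rewrite lt0n; apply: contraTneq leU => ->; rewrite muln0 -ltnNge.
  have := rn_gt0; rewrite !muln_gt0 s_gt0 /loss; lia.
(* [U'] is contained in [U], so the guaranteed shrinking factor is at most 1. *)
have dle : delta ^ 2 <= rate * n.
  rewrite -(leq_pmul2r U_gt0); apply: leq_trans leU' _.
  by rewrite leq_mul2l subset_leq_card ?orbT.
have le1 : rate * (s * loss) * n * (rate * n) ^ m <= delta ^ (2 * m).+1 * #|U'|.
  rewrite -(leq_pmul2l rn_gt0) mulnCA -expnS; apply: leq_trans leUm _.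
  have -> : (2 * m.+1).+1 = (2 * m).+1 + 2 by lia.
  by rewrite expnD -mulnA [X in _ <= X]mulnCA leq_mul2l leU' orbT.
(* By [dle], dropping the remaining [m] shrinking factors only weakens [le1], so the next step is
   permitted. *)
have le2 : rate * (s * loss) * n <= delta * #|U'|.
  rewrite -(leq_pmul2r (_ : 0 < (rate * n) ^ m)) ?expn_gt0 ?rn_gt0 //.
  apply: leq_trans le1 _; rewrite expnS expnM mulnAC leq_mul2l.
  by case: (m) => [|k]; rewrite ?expn0 ?leqnn ?orbT // leq_exp2r // dle orbT.
have [|T [U'' [cT spT jT leT]]] := IH _ _ _ (subset_trans U'U UA) spu jU' le2 le1.
  by rewrite cW; lia.
by exists T, U''; rewrite cT cW; split=> //; lia.
Qed.

End Spread.

(** * Embedding a subdivision *)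

Definition subdivision_embedding (V W : finType) (e : rel V) (L : {set {set W}})
    (phi : W -> V) (mid : {E : {set W} | E \in L} -> V) : Prop :=
  [/\ injective phi, injective mid, forall x E, phi x != mid E
    & forall x (E : {E : {set W} | E \in L}), x \in val E -> e (phi x) (mid E)].

Lemma contains_subdivision (n : nat) (G : {set {set 'I_n}}) (W : finType)
    (L : {set {set W}}) (phi : W -> 'I_n) (mid : {E : {set W} | E \in L} -> 'I_n) :
  subdivision_embedding (fun x y => [set x; y] \in G) phi mid ->
  contains_sub G (subdivision L).
Proof.
move=> [phi_inj mid_inj phi_mid phi_e].
apply/existsP; exists [ffun x => match x with inl v => phi v | inr E => mid E end].
apply/andP; split.
  apply/injectiveP => -[x|E] [y|F]; rewrite !ffunE.
  - by move=> /phi_inj ->.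
  - by move=> eq; have := phi_mid x F; rewrite eq eqxx.
  - by move=> eq; have := phi_mid y E; rewrite eq eqxx.
  - by move=> /mid_inj ->.
apply/forall_inP => F /imsetP [[x E]]; rewrite inE /= => xE ->.
by rewrite imsetU1 imset_set1 !ffunE phi_e.
Qed.

Lemma exists_distinct_representatives (I V : finType) (S : I -> {set V}) :
  (forall i, #|I| <= #|S i|) -> exists2 f : I -> V, injective f & forall i, f i \in S i.
Proof.
move=> leS.
have [f f_inj fS] : exists2 f : I -> V, {in enum I &, injective f}
    & forall i, f i \in S i.
  have := enum_uniq I; elim: (enum I) => [_|i l IH /= /andP[il uniq_l]].
    have /fin_all_exists [f fS] : forall i, exists x, x \in S i.
      move=> i; apply/card_gt0P; apply: leq_trans (leS i).
      by apply/card_gt0P; exists i.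
    by exists f.
  have [f f_inj fS] := IH uniq_l.
  have /card_gt0P [x] : 0 < #|S i :\: [set f j | j in l]|.
    have lt1 : size l < #|I|.
      have /card_uniqP eqs : uniq (i :: l) by rewrite /= il.
      by rewrite -[_.+1]/(size (i :: l)) -eqs max_card.
    have lt2 : #|[set f j | j in l]| <= size l.
      by apply: leq_trans (leq_imset_card _ _) (card_size _).
    have := cardsID [set f j | j in l] (S i).
    have := subset_leq_card (subsetIr (S i) [set f j | j in l]).
    have := leS i; lia.
  move=> /setDP [xS /imsetP xf].
  exists (fun j => if j == i then x else f j); last by move=> j; case: eqP => [->|].
  move=> j k; rewrite !inE; case: eqP => [->|_] /= jl; case: eqP => [->|_] //= kl eq.
  - by case: xf; exists k.
  - by case: xf; exists j.
  - exact: f_inj.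
by exists f => // i j; apply: f_inj; rewrite mem_enum.
Qed.

Lemma exists_set_injection (V : finType) (A : {set V}) (k : nat) :
  #|A| = k -> exists2 f : 'I_k -> V, injective f & forall i, f i \in A.
Proof.
by move=> <-; exists enum_val; [exact: enum_val_inj | exact: enum_valP].
Qed.

Section Embeddings.

Variables (V : finType) (e : rel V) (D : nat).
Hypothesis e_sym : symmetric e.

(** Removing the branch vertices from a heavy common neighbourhood leaves at least as many vertices
    as [L] has edges. *)
Lemma embed_heavy (W : finType) (L : {set {set W}}) (Q : {set V}) :
  {in L, forall E : {set W}, #|E| = 2} -> #|Q| = #|W| ->
  #|W| + #|{: {E : {set W} | E \in L}}| <= D ->
  {in Q &, forall x y, x != y -> D <= #|conb e x y|} ->
  exists phi, exists mid, subdivision_embedding (L := L) e phi mid.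
Proof.
move=> cL cQ leD hQ.
have [g g_inj gQ] := exists_set_injection cQ.
pose phi (x : W) := g (enum_rank x).
have phi_inj : injective phi by move=> x y /g_inj /enum_rank_inj.
pose S (E : {E : {set W} | E \in L}) :=
  [set b | [forall x in val E, e (phi x) b]] :\: [set phi x | x in W].
have leS E : #|{: {E : {set W} | E \in L}}| <= #|S E|.
  have /eqP/cards2P [x [y [nxy Exy]]] := cL _ (valP E).
  have lec : D <= #|[set b | [forall x in val E, e (phi x) b]]|.
    have := hQ _ _ (gQ (enum_rank x)) (gQ (enum_rank y)).
    rewrite (inj_eq phi_inj) nxy => /(_ isT) /leq_trans -> //.
    apply/subset_leq_card/subsetP => b; rewrite !inE => /andP[bx bY].
    by apply/forall_inP => z; rewrite Exy !inE => /orP[]/eqP->.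
  rewrite cardsD; apply: leq_trans (leq_sub lec _); last first.
    by apply: leq_trans (subset_leq_card (subsetIr _ _)) (leq_imset_card phi W).
  by rewrite leq_subRL ?(leq_trans (leq_addr _ _) leD).
have [mid mid_inj midS] := exists_distinct_representatives leS.
exists phi, mid; split=> // [x E|x E xE].
  apply: contraTneq (midS E) => <-; rewrite inE negb_and negbK.
  by rewrite imset_f.
by have := midS E; rewrite !inE => /andP[_ /forall_inP ->].
Qed.

(** Every edge of [EL s t] has an end in the part T, so its image is a light pair and any common
    neighbour can subdivide it. Independence of [W] keeps these vertices off the branch vertices. *)
Lemma embed_spread (s t : nat) (T W : {set V}) :
  spread e D T W -> T \subset W -> #|T| = t - 1 -> #|W| = s + (t - 1) ->
  exists phi, exists mid, subdivision_embedding (L := EL s t) e phi mid.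
Proof.
move=> [ind lnk tri] TW cT cW.
have cWT : #|W :\: T| = s by rewrite cardsDS // cW cT addnK.
have [g g_inj gT] := exists_set_injection cT.
have [h h_inj hT] := exists_set_injection cWT.
pose phi (x : VL s t) := match x with inl i => h i | inr j => g j end.
have phiW x : phi x \in W.
  case: x => [i|j] /=; last exact: (subsetP TW).
  by have /setDP[] := hT i.
have phiT x : inT x -> phi x \in T by case: x => [//|j] _; apply: gT.
have phi_inj : injective phi.
  move=> [i|j] [i'|j'] /=; try by [move=> /h_inj->|move=> /g_inj->].
  - by move=> eq; have := gT j'; rewrite -eq; have /setDP[_ /negbTE->] := hT i.
  - by move=> eq; have := gT j; rewrite eq; have /setDP[_ /negbTE->] := hT i'.
have ELP (E : {E : {set VL s t} | E \in EL s t}) : exists x y : VL s t,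
    [/\ val E = [set x; y], x != y & inT x].
  have := valP E; rewrite inE => /andP[/cards2P [x [y [nxy ->]]] /exists_inP [z]].
  rewrite !inE => /orP[]/eqP-> Tz; first by exists x, y.
  by exists y, x; rewrite setUC eq_sym.
have /fin_all_exists [mid midP] : forall E : {E : {set VL s t} | E \in EL s t},
    exists b, forall x, x \in val E -> e (phi x) b.
  move=> E; have [x [y [-> nxy Tx]]] := ELP E.
  have := lnk _ _ (phiT x Tx) (phiW y); rewrite (inj_eq phi_inj) => /(_ nxy).
  case/and3P=> _ /card_gt0P[b]; rewrite !inE => /andP[bx bY] _.
  by exists b => z; rewrite !inE => /orP[]/eqP->.
exists phi, mid; split=> // [E F eqEF|x E|x E]; last exact: midP.
  (* Both edges have two ends, so one inclusion suffices; an end of [F] outside [E] would give a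
     forbidden triple with a common neighbour. *)
  apply/val_inj/eqP; rewrite eq_sym eqEcard.
  have := valP E; rewrite inE => /andP[/eqP-> _].
  have := valP F; rewrite inE => /andP[/eqP-> _]; rewrite andbT.
  apply/subsetP => z zF; apply: contraT.
  have [x [y [Exy nxy Tx]]] := ELP E.
  rewrite Exy !inE => /norP[nzx nzy].
  have := tri _ _ _ (phiT x Tx) (phiW y) (phiW z).
  rewrite !(inj_eq phi_inj) => /(_ nxy); rewrite ![_ == z]eq_sym.
  move=> /(_ nzx nzy) /setP /(_ (mid E)).
  by rewrite !inE {3}eqEF !midP // Exy !inE eqxx ?orbT.
have [y [z [Eyz _ _]]] := ELP E.
have : e (phi y) (mid E) by apply: midP; rewrite Eyz !inE eqxx.
by apply: contraTneq => <-; apply: ind.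
Qed.

End Embeddings.

(** * The almost regular case *)

Lemma card_VL (s t : nat) : #|VL s t| = s + (t - 1).
Proof. by rewrite card_sum !card_ord. Qed.

Lemma embed_almost_regular (s t kappa : nat) : 0 < s -> 3 <= t ->
  exists c : nat, forall (V : finType) (e : rel V) (A B : {set V}) (n delta : nat),
    symmetric e -> irreflexive e -> (forall x y, e x y -> y \in B) ->
    #|B| <= n -> 0 < n -> 0 < delta ->
    {in A, forall x, delta <= #|nb e x|} ->
    (forall x, #|nb e x| <= kappa * delta) ->
    n <= kappa * #|A| -> c * n ^ (t - 2) <= delta ^ (2 * t - 3) ->
    exists phi, exists mid, subdivision_embedding (L := EL s t) e phi mid.
Proof.
move=> s_gt0 t_ge3; pose r := #|VL s t|.
pose D := r + #|{: {E : {set VL s t} | E \in EL s t}}|.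
pose loss := 1 + kappa + t * (D * kappa); pose rate := 16 * r * D.
pose K := rate * (s * loss); pose M := kappa * K * rate ^ (t - 2).
have r_gt0 : 0 < r by rewrite /r card_VL; lia.
have D_gt0 : 0 < D by rewrite /D; lia.
have rate_gt0 : 0 < rate by rewrite /rate !muln_gt0 r_gt0 D_gt0.
(* With this power the hypothesis yields both [M <= delta], because [0 < n], and
   [M * n ^ (t - 2) <= delta ^ (2 * t - 3)]; these give [h1] and [h2]. *)
exists (M ^ (2 * t - 3)).
move=> V e A B n delta e_sym e_irr eB leB n_gt0 d_gt0 degA deg_le leA led.
pose heavy (Q : {set V}) :=
  [forall x in Q, forall y in Q, (x != y) ==> (D <= #|conb e x y|)].
have heavyP (Q : {set V}) :
    reflect {in Q &, forall x y, x != y -> D <= #|conb e x y|} (heavy Q).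
  apply: (iffP forall_inP) => [h x y xQ yQ nxy|h x xQ].
    by have /forall_inP/(_ _ yQ)/implyP/(_ nxy) := h x xQ.
  by apply/forall_inP => y yQ; apply/implyP; apply: h.
have [/existsP [Q /and3P[_ /eqP cQ /heavyP hQ]]|noQ] :=
    boolP [exists Q : {set V}, [&& Q \subset A, #|Q| == r & heavy Q]].
  apply: (embed_heavy (D := D) (Q := Q)) => // E.
  by rewrite inE => /andP[/eqP->].
have no_heavy (Q : {set V}) : Q \subset A -> #|Q| = r ->
    ~ {in Q &, forall x y, x != y -> D <= #|conb e x y|}.
  move=> QA cQ /heavyP hQ; case/existsP: noQ.
  by exists Q; rewrite QA cQ eqxx.
have p_gt0 : 0 < 2 * t - 3 by lia.
have leMd : M <= delta.
  rewrite -(leq_exp2r _ _ p_gt0); apply: leq_trans led.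
  by rewrite leq_pmulr // expn_gt0 n_gt0.
have rpow_gt0 : 0 < rate ^ (t - 2) by rewrite expn_gt0 rate_gt0.
have leKA : K * n <= K * (kappa * #|A|) by rewrite leq_mul2l leA orbT.
have h1 : K * n <= delta * #|A|.
  apply: leq_trans leKA _; rewrite mulnA leq_mul2r; apply/orP; right.
  by apply: leq_trans leMd; rewrite /M (mulnC K) leq_pmulr.
have h2 : K * n * (rate * n) ^ (t - 2) <= delta ^ (2 * (t - 2)).+1 * #|A|.
  have -> : (2 * (t - 2)).+1 = 2 * t - 3 by lia.
  have : M ^ (2 * t - 3) * n ^ (t - 2) * #|A| <= delta ^ (2 * t - 3) * #|A|.
    by rewrite leq_mul2r led orbT.
  apply: leq_trans.
  have : M * (n ^ (t - 2) * #|A|) <= M ^ (2 * t - 3) * n ^ (t - 2) * #|A|.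
    rewrite -mulnA leq_mul2r; apply/orP; right.
    have [->|M_gt0] := posnP M; first by [].
    by rewrite -[X in X <= _]expn1 leq_pexp2l.
  apply: leq_trans; rewrite expnMn /M.
  have := leq_mul leKA (leqnn (rate ^ (t - 2) * n ^ (t - 2))); lia.
have [|||T [U [cT spT jT leU]]] := spread_extendT e_sym e_irr (A := A) (B := B)
  (W := set0) (U := A) (m := t - 2) (t := t) (kappa := kappa) eB leB r_gt0 D_gt0
  n_gt0 s_gt0 d_gt0 no_heavy degA deg_le _ (subxx A) _ _ h1 h2.
- by rewrite cards0; lia.
- by split=> [x y|x y|x y z]; rewrite inE.
- by move=> z _; split=> [|x|x|x y]; rewrite inE.
have {}cT : #|T| = t - 1 by rewrite cT cards0; lia.
have [|W spW /andP[TW /eqP cW]] := spread_extendS e_sym e_irr deg_le (subxx T) spT jT (s := s).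
  apply: leq_trans leU; rewrite -mulnA leq_mul2l; apply/orP; right.
  have : #|T| * (D * (kappa * delta)) <= t * (D * (kappa * delta)).
    by rewrite leq_mul2r cT leq_subr orbT.
  by rewrite /loss; nia.
by apply: (embed_spread spW TW cT); rewrite cW cT addnC.
Qed.

(** * Passing to an almost regular subgraph *)

Section Arcs.

Variables (V : finType) (e : rel V).
Implicit Types X Y Z H : {set V}.

(* Ordered pairs, so [arcs X X] is twice the number of edges inside [X]. *)
Definition arcs X Y : nat := \sum_(x in X) \sum_(y in Y) e x y.

Lemma card_nb_in Y x : \sum_(y in Y) e x y = #|[set y in Y | e x y]|.
Proof.
rewrite -sum1_card [RHS](eq_bigl (fun y => (y \in Y) && e x y)); last first.
  by move=> y; rewrite inE.
by rewrite big_mkcondr; apply: eq_bigr => y _; case: (e x y).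
Qed.

Lemma arcsC X Y : symmetric e -> arcs X Y = arcs Y X.
Proof.
move=> e_sym; rewrite /arcs exchange_big /=.
by apply: eq_bigr => y _; apply: eq_bigr => x _; rewrite e_sym.
Qed.

Lemma arcsDl X Y Z : arcs X Y = arcs (X :&: Z) Y + arcs (X :\: Z) Y.
Proof. exact: big_setID. Qed.

Lemma arcsDr X Y Z : arcs X Y = arcs X (Y :&: Z) + arcs X (Y :\: Z).
Proof.
by rewrite /arcs -big_split; apply: eq_bigr => x _; apply: big_setID.
Qed.

Lemma arcsS X Y X' Y' : X \subset X' -> Y \subset Y' -> arcs X Y <= arcs X' Y'.
Proof.
move=> XX' YY'; rewrite (arcsDl X' Y' X) (arcsDr _ Y' Y).
by rewrite (setIidPr XX') (setIidPr YY') -addnA leq_addr.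
Qed.

Lemma arcs_le X Y : arcs X Y <= #|X| * #|Y|.
Proof.
rewrite -sum_nat_const; apply: leq_sum => x _; rewrite -sum1_card.
by apply: leq_sum => y _; exact: leq_b1.
Qed.

(** Pieces of at most [m] vertices are split off [Z] one at a time; [arcs] is additive in its second
    argument. *)
Lemma arcs_cover (m k M : nat) H Z : #|Z| <= k * m ->
  (forall Y, Y \subset Z -> #|Y| <= m -> arcs H Y <= M) -> arcs H Z <= k * M.
Proof.
elim: k Z => [|k IH] Z leZ leM.
  have /eqP : #|Z| == 0 by rewrite -leqn0.
  by move/cards0_eq->; rewrite /arcs big1 // => x _; rewrite big_set0.
pose Y : {set V} := [set x in take m (enum Z)].
have cY : #|Y| = minn m #|Z|.
  rewrite cardsE; have /card_uniqP -> : uniq (take m (enum Z)).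
    by rewrite take_uniq ?enum_uniq.
  by rewrite size_take_min -cardE.
have YZ : Y \subset Z.
  by apply/subsetP => x; rewrite inE => /mem_take; rewrite mem_enum.
rewrite (arcsDr H Z Y) (setIidPr YZ) mulSn leq_add //.
  by apply: leM; rewrite ?cY ?geq_minl.
apply: IH => [|Y' Y'Z]; last by apply: leM; apply: subset_trans Y'Z (subsetDl _ _).
by rewrite cardsDS // cY; lia.
Qed.

End Arcs.

(** Vertices of degree at least [K] times the average number at most [#|X| / K]. Each [H :|: Y] of
    the cover has at most [4 * #|X| / K] vertices, and minimality leaves it at most a fraction
    [1 / (4 * K)] of the arcs. *)
Lemma arcs_high_degree (V : finType) (e : rel V) (p q C K : nat) (X : {set V}) :
  0 < p -> p < q -> 4 ^ (p + q) <= K -> K < #|X| ->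
  (forall Y : {set V}, Y \subset X -> #|Y| < #|X| -> arcs e Y Y ^ p <= C * #|Y| ^ q) ->
  C * #|X| ^ q < arcs e X X ^ p ->
  4 * arcs e [set x in X | K * arcs e X X <= #|X| * \sum_(y in X) e x y] X
    <= arcs e X X.
Proof.
move=> p_gt0 ltpq leK ltKX IH; set F := arcs e X X; set n := #|X| => ltF.
set H := [set x in X | _].
have HX : H \subset X by apply/subsetP => x; rewrite inE => /andP[].
have F_gt0 : 0 < F by rewrite lt0n; apply: contraTneq ltF => ->; rewrite exp0n // ltn0.
have K5 : 5 <= K.
  apply: leq_trans leK; apply: (@leq_trans (4 ^ 2)) => //.
  by rewrite leq_exp2l //; lia.
have cH : #|H| * K <= n.
  rewrite -(leq_pmul2r F_gt0) -mulnA -sum_nat_const.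
  apply: (@leq_trans (\sum_(x in H) n * \sum_(y in X) e x y)).
    by apply: leq_sum => x; rewrite inE => /andP[].
  by rewrite -big_distrr leq_mul2l /= (arcsS e HX (subxx X)) orbT.
pose m := (n %/ K).+1.
have lenm : n <= K * m by rewrite /m mulnS {1}(divn_eq n K); lia.
have leHX : arcs e H X <= K * (F %/ (4 * K)).
  apply: (arcs_cover (m := m)) lenm _ => Y YX leY.
  have HYX : H :|: Y \subset X by rewrite subUset HX.
  have cHY : K * #|H :|: Y| <= 4 * n.
    apply: leq_trans (leq_mul (leqnn K) (leq_card_setU H Y)) _.
    have : K * #|Y| <= K * m by rewrite leq_mul2l leY orbT.
    have : K * (n %/ K) <= n by rewrite mulnC leq_divM.
    by rewrite /m mulnS mulnDr [K * #|H|]mulnC; lia.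
  rewrite leq_divRL; last by lia.
  apply: (@leq_trans (4 * K * arcs e (H :|: Y) (H :|: Y))).
    by rewrite mulnC leq_mul2l arcsS ?subsetUl ?subsetUr ?orbT.
  have ltHY : #|H :|: Y| < n by nia.
  have := IH _ HYX ltHY; set a := arcs e _ _; set y := #|_| in cHY ltHY * => lea.
  (* Scaled by [K ^ q], the claim reduces to [4 ^ (p + q) * K ^ p <= K ^ q], which holds since
     [p < q] and [4 ^ (p + q) <= K]. *)
  rewrite -(leq_exp2r _ _ p_gt0) -(leq_pmul2l (_ : 0 < K ^ q)); last by rewrite expn_gt0; lia.
  have s1 : K ^ q * (4 * K * a) ^ p <= (4 ^ p * K ^ p * C) * (K * y) ^ q.
    rewrite !expnMn; have := leq_mul (leqnn (K ^ q * (4 ^ p * K ^ p))) lea; lia.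
  apply: leq_trans s1 _.
  have s2 : (4 ^ p * K ^ p * C) * (K * y) ^ q <= (4 ^ p * K ^ p * C) * (4 * n) ^ q.
    by rewrite leq_mul2l leq_exp2r ?cHY ?orbT //; lia.
  apply: leq_trans s2 _.
  have s3 : (4 ^ p * K ^ p * C) * (4 * n) ^ q <= 4 ^ (p + q) * K ^ p * F ^ p.
    rewrite expnMn expnD.
    have := leq_mul (leqnn (4 ^ p * 4 ^ q * K ^ p)) (ltnW ltF); lia.
  apply: leq_trans s3 _; rewrite leq_mul2r; apply/orP; right.
  apply: (@leq_trans (K ^ p.+1)); first by rewrite expnS leq_mul2r leK orbT.
  by rewrite leq_pexp2l //; lia.
apply: leq_trans (leq_mul (leqnn 4) leHX) _; rewrite mulnA.
by rewrite mulnC leq_divM.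
Qed.

Lemma arcs_bound (s t : nat) : 0 < s -> 3 <= t ->
  exists C : nat, forall (V : finType) (e : rel V), symmetric e -> irreflexive e ->
    (forall phi mid, ~ subdivision_embedding (L := EL s t) e phi mid) ->
    forall X : {set V}, arcs e X X ^ (2 * t - 3) <= C * #|X| ^ (3 * t - 5).
Proof.
move=> s_gt0 t_ge3.
set p := 2 * t - 3; set q := 3 * t - 5.
have p_gt0 : 0 < p by rewrite /p; lia.
have ltpq : p < q by rewrite /p /q; lia.
have qE : q = p + (t - 2) by rewrite /p /q; lia.
pose K := 4 ^ (p + q).
have [c embed] := embed_almost_regular (8 * K) s_gt0 t_ge3.
(* The three terms exclude [n <= K], exclude [F <= 4 * n], and supply the density that [embed]
   needs, in this order. *)
pose C := K ^ p + 4 ^ p + 8 ^ p * c.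
exists C => V e e_sym e_irr no_emb X.
have [k] := ubnP #|X|; elim: k X => // k IH X; rewrite ltnS => leXk.
rewrite leqNgt; apply/negP => ltF.
set F := arcs e X X in ltF; set n := #|X| in leXk ltF.
have n_gt0 : 0 < n.
  rewrite lt0n; apply: contraTneq ltF => n0.
  by have := arcs_le e X X; rewrite -/F -/n n0 leqn0 => /eqP->; rewrite (exp0n p_gt0) ltn0.
have F4n : 4 * n < F.
  rewrite -(ltn_exp2r _ _ p_gt0); apply: leq_ltn_trans ltF.
  rewrite expnMn leq_mul ?leq_pexp2l ?(ltnW ltpq) //.
  by rewrite /C; lia.
have ltKn : K < n.
  rewrite ltnNge; apply/negP => lenK.
  have : F ^ p <= K ^ p * n ^ p.
    by rewrite -expnMn leq_exp2r // (leq_trans (arcs_le e X X)) // leq_mul2r lenK orbT.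
  have : K ^ p * n ^ p <= C * n ^ q.
    by rewrite leq_mul ?leq_pexp2l ?(ltnW ltpq) // /C; lia.
  by move: ltF; lia.
pose H := [set x in X | K * F <= n * \sum_(y in X) e x y].
have leH : 4 * arcs e H X <= F.
  apply: arcs_high_degree ltF => // Y YX ltY; apply: IH; exact: leq_trans ltY leXk.
have HX : H \subset X by apply/subsetP => x; rewrite inE => /andP[].
pose B := X :\: H.
have BX : B \subset X by apply: subsetDl.
pose f x y := [&& x \in B, y \in B & e x y].
have nbf x : x \in B -> #|nb f x| = \sum_(y in B) e x y.
  move=> xB; rewrite card_nb_in; apply: eq_card => y.
  by rewrite [in LHS]inE [in RHS]inE /f xB.
(* Arcs with an end in [H] number at most [2 * arcs e H X], hence at most half of [F]. *)
have FB : F <= 2 * arcs e B B.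
  have E1 : F = arcs e H X + arcs e B X.
    by rewrite /F (arcsDl e X X H) (setIidPr HX).
  have E2 : arcs e B X = arcs e B H + arcs e B B.
    by rewrite (arcsDr e B X H) (setIidPr HX).
  have : arcs e B H <= arcs e H X by rewrite arcsC // arcsS.
  by move: leH E1 E2; lia.
(* A quarter of the average degree, rounded down; it is positive by [F4n], so rounding costs at most
   a factor 2. *)
pose delta := F %/ (4 * n).
have leF : 4 * n * delta <= F by rewrite mulnC leq_divM.
have d_gt0 : 0 < delta by rewrite divn_gt0; lia.
have Fle : F <= 8 * n * delta.
  have := ltn_ceil F (_ : 0 < 4 * n); rewrite -/delta => /(_ ltac:(lia)).
  by nia.
have degB x : #|nb f x| <= 8 * K * delta.
  have [xB|xB] := boolP (x \in B); last first.
    by rewrite (_ : nb f x = set0) ?cards0 //; apply/setP => y; rewrite !inE /f (negbTE xB).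
  rewrite nbf //; move: (xB); rewrite !inE => /andP[nH xX].
  move: nH; rewrite xX /= -ltnNge => lt.
  have : \sum_(y in B) e x y <= \sum_(y in X) e x y.
    by rewrite [X in _ <= X](big_setID B) /= (setIidPr BX) leq_addr.
  move=> le; rewrite -(leq_pmul2l n_gt0).
  apply: leq_trans (leq_mul (leqnn n) le) _; apply: leq_trans (ltnW lt) _.
  have := leq_mul (leqnn K) Fle; lia.
pose A := [set x in B | delta <= #|nb f x|].
have [||||||||||phi [mid [phi_inj mid_inj phi_mid phi_f]]] := embed V f A B n delta.
- by move=> x y; rewrite /f e_sym andbCA.
- by move=> x; rewrite /f e_irr !andbF.
- by move=> x y /and3P[].
- exact: subset_leq_card.
- by [].
- by [].
- by move=> x; rewrite inE => /andP[].
- by [].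
(* Of the at least [2 * n * delta] arcs in [B], vertices outside [A] account for at most
   [n * delta]; each vertex of [A] has at most [8 * K * delta]. *)
- have AB : A \subset B by apply/subsetP => x; rewrite inE => /andP[].
  have E : arcs e B B = \sum_(x in A) #|nb f x| + \sum_(x in B :\: A) #|nb f x|.
    rewrite (arcsDl e B B A) (setIidPr AB); congr (_ + _); apply: eq_bigr => x.
      by move=> /(subsetP AB) xB; rewrite nbf.
    by move=> /setDP[xB _]; rewrite nbf.
  have le1 : \sum_(x in A) #|nb f x| <= #|A| * (8 * K * delta).
    by rewrite -sum_nat_const; apply: leq_sum.
  have le2 : \sum_(x in B :\: A) #|nb f x| <= n * delta.
    apply: (@leq_trans (#|B :\: A| * delta)).
      rewrite -sum_nat_const; apply: leq_sum => x /setDP[xB].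
      by rewrite inE xB /= -ltnNge => /ltnW.
    by rewrite leq_mul2r subset_leq_card ?orbT // (subset_trans (subsetDl _ _)).
  rewrite -(leq_pmul2r d_gt0); lia.
- have Fp : F ^ p <= 8 ^ p * n ^ p * delta ^ p by rewrite -!expnMn leq_exp2r.
  have np : 0 < 8 ^ p * n ^ p by rewrite muln_gt0 !expn_gt0 n_gt0.
  rewrite -(leq_pmul2l np); apply: leq_trans Fp; apply: leq_trans (ltnW ltF).
  rewrite qE expnD.
  have : 8 ^ p * c * (n ^ p * n ^ (t - 2)) <= C * (n ^ p * n ^ (t - 2)).
    by rewrite leq_mul2r /C leq_addl orbT.
  lia.
apply: (no_emb phi mid); split=> // x E xE.
by have /and3P[] := phi_f x E xE.
Qed.

(** Each edge of [G] arises from an ordered adjacent pair, so [arcs] over all vertices bounds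
    [#|G|]. *)
Lemma ex_L'_pow_le (s t : nat) : 0 < s -> 3 <= t ->
  exists C : nat, forall n : nat, ex n (L' s t) ^ (2 * t - 3) <= C * n ^ (3 * t - 5).
Proof.
move=> s_gt0 t_ge3; have [C bound] := arcs_bound s_gt0 t_ge3.
exists C => n; rewrite /ex.
apply: (big_ind (fun m => m ^ (2 * t - 3) <= C * n ^ (3 * t - 5))).
- by rewrite exp0n //; lia.
- by move=> a b lea leb; rewrite /maxn; case: ifP.
move=> G /andP[/forall_inP simG nG].
pose e (x y : 'I_n) := [set x; y] \in G.
have e_sym : symmetric e by move=> x y; rewrite /e setUC.
have e_irr : irreflexive e.
  move=> x; apply/negP => /simG; rewrite setUid cards1 //.
have no_emb phi mid : ~ subdivision_embedding (L := EL s t) e phi mid.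
  by move=> emb; case/negP: nG; apply: contains_subdivision emb.
have := bound _ e e_sym e_irr no_emb [set: 'I_n]; rewrite cardsT card_ord.
apply: leq_trans; rewrite leq_exp2r; last by lia.
pose P := [set u : 'I_n * 'I_n | e u.1 u.2].
have GP : G \subset [set [set u.1; u.2] | u in P].
  apply/subsetP => E EG; have /cards2P [x [y [_ Exy]]] := simG E EG.
  by apply/imsetP; exists (x, y); rewrite ?inE /e -?Exy.
apply: leq_trans (subset_leq_card GP) _; apply: leq_trans (leq_imset_card _ _) _.
rewrite /arcs pair_big /= -sum1_card big_mkcond /= [X in _ <= X]big_mkcond /=.
by apply: leq_sum => u _; rewrite !inE /=; case: (e _ _).
Qed.

(** * Real exponents *)

Lemma INR_expn (m k : nat) : INR (m ^ k) = (INR m ^ k)%R.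
Proof. by elim: k => [|k IH] //; rewrite expnS mult_INR IH. Qed.

Lemma INR_le (m n : nat) : m <= n -> (INR m <= INR n)%R.
Proof. by move=> /leP; apply: le_INR. Qed.

(** Otherwise taking [p]-th powers contradicts the hypothesis, as [C <= C.+1 ^ p]; the successor
    keeps the constant positive even for [C = 0]. *)
Lemma root_bound (m n p q C : nat) : 0 < n -> 0 < p -> m ^ p <= C * n ^ q ->
  (INR m <= INR C.+1 * Rpower (INR n) (INR q / INR p))%R.
Proof.
move=> n_gt0 p_gt0 le.
have n_gt0R : (0 < INR n)%R by apply: lt_0_INR; apply/leP.
have p_gt0R : (0 < INR p)%R by apply: lt_0_INR; apply/leP.
set y := Rpower _ _.
have y_gt0 : (0 < y)%R by apply: exp_pos.
have ypow : (y ^ p = INR n ^ q)%R.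
  rewrite -Rpower_pow // /y Rpower_mult -(Rpower_pow q) //; congr Rpower.
  by field; lra.
have C_gt0 : (0 < INR C.+1)%R by apply: lt_0_INR; apply/leP.
apply: Rnot_lt_le => lt.
have : ((INR C.+1 * y) ^ p < INR m ^ p)%R.
  have Cy_gt0 : (0 < INR C.+1 * y)%R by apply: Rmult_lt_0_compat.
  rewrite -!Rpower_pow //; last exact: Rlt_trans Cy_gt0 lt.
  exact: Rlt_Rpower_l.
rewrite Rpow_mult_distr ypow -!INR_expn -mult_INR.
apply: Rle_not_lt; apply: INR_le; apply: leq_trans le _.
rewrite leq_mul2r; apply/orP; right; apply: leq_trans (leqnSn C) _.
by rewrite -[X in X <= _]expn1 leq_pexp2l.
Qed.

Theorem theorem4 :
  forall s t : nat, (1 <= s)%N -> (3 <= t)%N ->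
  exists C : R, forall n : nat, (0 < n)%N ->
    (INR (ex n (L' s t)) <= C * Rpower (INR n) (3 / 2 - 1 / INR (4 * t - 6)))%R.
Proof.
move=> s t s_gt0 t_ge3; have [C bound] := ex_L'_pow_le s_gt0 t_ge3.
exists (INR C.+1) => n n_gt0.
have -> : (3 / 2 - 1 / INR (4 * t - 6) = INR (3 * t - 5) / INR (2 * t - 3))%R.
  (* Writing [t] as [k.+3] removes the truncated subtractions before passing to the reals. *)
  have {t_ge3 bound} [k ->] : exists k, t = k.+3 by exists (t - 3); lia.
  have -> : (4 * k.+3 - 6 = 2 * (2 * k + 3))%N by lia.
  have -> : (3 * k.+3 - 5 = 3 * k + 4)%N by lia.
  have -> : (2 * k.+3 - 3 = 2 * k + 3)%N by lia.
  rewrite !(mult_INR, plus_INR) /=; have := pos_INR k => k_ge0.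
  by field; lra.
by apply: root_bound => //; lia.
Qed.
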